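(* Let $q=(1+uy)/(1+y)$. For $n\ge1$ let $s_n(u,y)=\sum_D u^{\operatorname{des}(D)}y^{e(D)}$, the sum over all strongly connected digraphs $D$ on $[n]$, and let $S(x)=\sum_{n\ge1}s_n(u,y)\frac{x^n}{n!}$. Let \[D(x)=\sum_{n=0}^\infty (1+uy)^{\binom n2}\frac{x^n}{n!_q}.\] Let $\Delta$ be the linear map on formal power series in $x$ defined by \[\Delta\Bigl(\sum_{n\ge0}a_n\frac{x^n}{n!}\Bigr)=\sum_{n\ge0}a_n\frac{x^n}{n!_q\,(1+y)^{\binom n2}}.\] Then \[S(x)=-\log\bigl(\Delta^{-1}(D(x)^{-1})\bigr).\]
   Context: All series are formal power series in $x$ with coefficients in the field $\mathbb{Q}(u,y)$. A digraph on a finite set $V$ of integers is a set $E\subseteq V\times V$ of ordered pairs $(s,t)$ with $s\neq t$ (its edges); $e(D)$ is the number of edges. A descent is an edge $(s,t)$ with $s>t$; $\operatorname{des}(D)$ is the number of descents. A digraph is strongly connected if for every two vertices $a,b$ there is a directed path from $a$ to $b$ (the empty path allowed when $a=b$). The $q$-factorial is $n!_q=\prod_{k=1}^n(1+q+\cdots+q^{k-1})$. *)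

(* Defs.v *)
From HB Require Import structures.
From mathcomp Require Import all_boot all_order all_algebra.
From mathcomp Require Import mpoly.

Set Implicit Arguments.
Unset Strict Implicit.
Unset Printing Implicit Defensive.

Import GRing.Theory.
Local Open Scope ring_scope.

(* [f n] is the coefficient of x^n (not of x^n/n!).  Equality of series is
   [f =1 g]. *)
Definition fps (F : fieldType) : Type := nat -> F.

Definition fps_one {F : fieldType} : fps F := fun n => (n == 0%N)%:R.

Definition fps_opp {F : fieldType} (f : fps F) : fps F := fun n => - f n.

Definition fps_sub {F : fieldType} (f g : fps F) : fps F :=
  fun n => f n - g n.

Definition fps_scale {F : fieldType} (c : F) (f : fps F) : fps F :=
  fun n => c * f n.

Definition fps_mul {F : fieldType} (f g : fps F) : fps F :=
  fun n => \sum_(i < n.+1) f i * g (n - i)%N.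

Definition fps_exp {F : fieldType} (f : fps F) (k : nat) : fps F :=
  iter k (fps_mul f) fps_one.

(* For f with c := f 0 nonzero, 1/f = c^-1 * sum_k (1 - f/c)^k.  The terms
   k > n do not contribute to the coefficient of x^n ([fps_exp_lt]). *)
Definition fps_inv {F : fieldType} (f : fps F) : fps F :=
  fun n => (f 0%N)^-1 *
    \sum_(k < n.+1) fps_exp (fps_sub fps_one (fps_scale (f 0%N)^-1 f)) k n.

(* For f with f 0 = 1, log f = sum_(k >= 1) (-1)^(k-1) (f - 1)^k / k.  The
   terms k > n do not contribute to the coefficient of x^n. *)
Definition fps_log {F : fieldType} (f : fps F) : fps F :=
  fun n => \sum_(1 <= k < n.+1)
    ((-1) ^+ k.-1 / k%:R) * fps_exp (fps_sub f fps_one) k n.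

Lemma fps_exp_lt (F : fieldType) (f : fps F) (k n : nat) :
  f 0%N = 0 -> (n < k)%N -> fps_exp f k n = 0.
Proof.
move=> f0; elim: k n => [|k IHk] n //= lt_nk.
rewrite /fps_mul big1 // => -[[|i] lt_in] _ /=; first by rewrite f0 mul0r.
rewrite IHk ?mulr0 //; apply: leq_trans (_ : n <= k)%N => //.
by rewrite ltn_subrL /=; case: n lt_in lt_nk.
Qed.

Lemma fps_mulV (F : fieldType) (f : fps F) :
  f 0%N != 0 -> fps_mul f (fps_inv f) =1 fps_one.
Proof.
move=> f0 n; set h := fps_sub fps_one (fps_scale (f 0%N)^-1 f).
have h0 : h 0%N = 0 by rewrite /h /fps_sub /fps_scale /fps_one mulVf ?subrr.
have fE i : f i * (f 0%N)^-1 = fps_one i - h i.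
  by rewrite /h /fps_sub /fps_scale opprB addrC subrK mulrC.
transitivity (\sum_(k < n.+1) \sum_(i < n.+1)
                (fps_one i - h i) * fps_exp h k (n - i)%N).
  rewrite exchange_big; apply: eq_bigr => i _ /=.
  rewrite /fps_inv -/h mulrA fE -mulr_sumr; congr (_ * _).
  rewrite (big_ord_widen n.+1 (fun k => fps_exp h k (n - i)%N)) ?ltnS ?leq_subr //.
  rewrite big_mkcond /=; apply: eq_bigr => k _.
  by case: ltnP => // lt_nk; rewrite fps_exp_lt.
have step k : \sum_(i < n.+1) (fps_one i - h i) * fps_exp h k (n - i)%N
    = fps_exp h k n - fps_exp h k.+1 n.
  under eq_bigr do rewrite mulrBl.
  rewrite sumrB; congr (_ - _).
  rewrite big_ord_recl big1 ?addr0 /fps_one /= ?mul1r ?subn0 // => i _.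
  by rewrite mul0r.
rewrite (eq_bigr _ (fun (k : 'I_n.+1) _ => step k)).
rewrite -(big_mkord xpredT (fun k => fps_exp h k n - fps_exp h k.+1 n)).
rewrite (@telescope_sumr_eq _ _ _ (fun k => - fps_exp h k n)) // => [|k _].
  by rewrite opprK addrC (fps_exp_lt h0 (ltnSn n)) subr0.
by rewrite opprK addrC.
Qed.

(* The vertex set [n] = {1, ..., n} is encoded by 'I_n through i |-> i + 1;
   this preserves the order, hence the descents. *)
Definition is_digraph (n : nat) (E : {set 'I_n * 'I_n}) : bool :=
  [forall e in E, e.1 != e.2].

Definition des (n : nat) (E : {set 'I_n * 'I_n}) : nat :=
  #|[set e in E | (e.2 < e.1)%N]|.

Definition strongly_connected (n : nat) (E : {set 'I_n * 'I_n}) : bool :=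
  [forall a, forall b, connect (fun s t => (s, t) \in E) a b].

Definition s_ {F : fieldType} (u y : F) (n : nat) : F :=
  \sum_(E : {set 'I_n * 'I_n} | is_digraph E && strongly_connected E)
    u ^+ des E * y ^+ #|E|.

(* The sum starts at n = 1: the empty digraph on no vertices is not counted. *)
Definition S_ {F : fieldType} (u y : F) : fps F :=
  fun n => if n == 0%N then 0 else s_ u y n / n`!%:R.

Definition qfact {F : fieldType} (q : F) (n : nat) : F :=
  \prod_(1 <= k < n.+1) \sum_(i < k) q ^+ i.

Definition q_ {F : fieldType} (u y : F) : F := (1 + u * y) / (1 + y).

Definition D_ {F : fieldType} (u y : F) : fps F :=
  fun n => (1 + u * y) ^+ 'C(n, 2) / qfact (q_ u y) n.

(* If f = sum_n a_n x^n/n!, then a_n = n! * f n. *)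
Definition Delta {F : fieldType} (u y : F) (f : fps F) : fps F :=
  fun n => (n`!%:R * f n) / (qfact (q_ u y) n * (1 + y) ^+ 'C(n, 2)).

(* The two-sided inverse of [Delta] at the indeterminates of Q(u,y); see
   [DeltaK] and [Delta_invK]. *)
Definition Delta_inv {F : fieldType} (u y : F) (f : fps F) : fps F :=
  fun n => (f n * (qfact (q_ u y) n * (1 + y) ^+ 'C(n, 2))) / n`!%:R.

Definition Quy : fieldType := {fraction {mpoly rat[2]}}.

Definition uvar : Quy := tofrac 'X_ord0.
Definition yvar : Quy := tofrac 'X_ord_max.

Lemma natr_Quy_neq0 (n : nat) : (0 < n)%N -> n%:R != 0 :> Quy.
Proof.
move=> n_gt0; rewrite -(rmorph_nat (@tofrac {mpoly rat[2]})) tofrac_eq0.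
by rewrite -(rmorph_nat (@mpolyC 2 rat)) mpolyC_eq0 Num.Theory.pnatr_eq0 -lt0n.
Qed.

Lemma add1y_neq0 : 1 + yvar != 0.
Proof.
rewrite /yvar -tofrac1 -tofracD tofrac_eq0.
apply/eqP => /(congr1 (meval (fun=> 0))).
by rewrite mevalD mevalXU meval1 meval0 addr0 => /eqP; rewrite oner_eq0.
Qed.

Lemma qfact_neq0 (n : nat) : qfact (q_ uvar yvar) n != 0.
Proof.
rewrite /qfact prodf_seq_neq0; apply/allP => k; rewrite mem_index_iota /=.
case/andP=> k_gt0 _.
pose a : {mpoly rat[2]} := 1 + 'X_ord0 * 'X_ord_max.
pose b : {mpoly rat[2]} := 1 + 'X_ord_max.
have bE : tofrac b = 1 + yvar by rewrite tofracD tofrac1.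
have aE : tofrac a = 1 + uvar * yvar by rewrite tofracD tofracM tofrac1.
suff: (1 + yvar) ^+ k * \sum_(i < k) q_ uvar yvar ^+ i != 0.
  by apply: contraNneq => ->; rewrite mulr0.
have -> : (1 + yvar) ^+ k * \sum_(i < k) q_ uvar yvar ^+ i
    = tofrac (\sum_(i < k) b ^+ (k - i) * a ^+ i).
  rewrite mulr_sumr rmorph_sum; apply: eq_bigr => i _ /=.
  rewrite tofracM !tofracXn bE aE /q_ expr_div_n mulrCA mulrC; congr (_ * _).
  by rewrite -expfB_cond // (negPf add1y_neq0) (ltnW (ltn_ord i)).
rewrite tofrac_eq0; apply/eqP => /(congr1 (meval (fun=> 0))).
rewrite rmorph_sum meval0 /= (eq_bigr (fun=> 1)) => [|i _].
  rewrite sumr_const card_ord => /eqP.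
  by rewrite Num.Theory.pnatr_eq0 eqn0Ngt k_gt0.
rewrite mevalM !rmorphXn /= /a /b !mevalD mevalM !mevalXU meval1.
by rewrite mulr0 !addr0 !expr1n mulr1.
Qed.

Lemma Delta_scale_neq0 (n : nat) :
  qfact (q_ uvar yvar) n * (1 + yvar) ^+ 'C(n, 2) != 0.
Proof. by rewrite mulf_neq0 ?qfact_neq0 ?expf_neq0 ?add1y_neq0. Qed.

Lemma DeltaK (f : fps Quy) :
  Delta_inv uvar yvar (Delta uvar yvar f) =1 f.
Proof.
move=> n; rewrite /Delta_inv /Delta divfK ?Delta_scale_neq0 //.
by rewrite mulrC mulKf // natr_Quy_neq0 ?fact_gt0.
Qed.

Lemma Delta_invK (f : fps Quy) :
  Delta uvar yvar (Delta_inv uvar yvar f) =1 f.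
Proof.
move=> n; rewrite /Delta_inv /Delta [_%:R * _]mulrC divfK.
  by rewrite mulfK ?Delta_scale_neq0.
by rewrite natr_Quy_neq0 ?fact_gt0.
Qed.

Lemma D_0 (F : fieldType) (u y : F) : D_ u y 0%N = 1.
Proof. by rewrite /D_ /qfact big_geq // bin0n expr0 divr1. Qed.

(* The series whose logarithm is taken has constant term 1. *)
Lemma Delta_inv_invD_0 (F : fieldType) (u y : F) :
  Delta_inv u y (fps_inv (D_ u y)) 0%N = 1.
Proof.
rewrite /Delta_inv /fps_inv D_0 big_ord1 /= /fps_one /qfact big_geq //.
by rewrite bin0n /= mulr1n invr1 !mul1r.
Qed.

(* Main.v *)
(** A strong component of a digraph on V is a source component when no edge
    enters it from outside.  Weight a set P of disjoint nonempty strongly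
    connected blocks by (-1)^|P|, and let e(A) be the resulting signed sum over
    the digraphs on A all of whose components are isolated and strongly
    connected; so e is exp(-S) at the level of vertex sets.  Summing e(A),
    times the weight of arbitrary edges from A to V\A, times the weight of
    arbitrary digraphs on V\A, counts each digraph on V once for each set P of
    its source components, with sign (-1)^|P|; every nonempty digraph has a
    source component, so the total is 0.  The edges from A to V\A, summed over
    the sets A of size k, give the q-binomial coefficient times (1+y)^(k(n-k)),
    so the identity reads D * Delta(exp(-S)) = 1.

    The identity determines e(V) recursively, so e(V) depends only on |V| and
    is |V|! times the coefficient of Delta^{-1}(1/D).  The strong weights of the
    subsets of V are in turn determined by e, by splitting off the block that
    contains a fixed vertex; on power series this recursion is the differential
    equation x f' = x (log f)' f.  Hence they, too, depend on the cardinality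
    only, and relabelling digraphs along order isomorphisms is never needed. *)
Require Import Defs.
From mathcomp Require Import all_boot all_order all_algebra.
From mathcomp Require Import mpoly.
From mathcomp Require Import ring zify.

Set Implicit Arguments.
Unset Strict Implicit.
Unset Printing Implicit Defensive.

Import GRing.Theory.
Local Open Scope ring_scope.

(** * Sums over subsets of a finite set *)

Lemma sum_subsetU (T : finType) (M : nmodType) (X Y : {set T})
    (F : {set T} -> M) : [disjoint X & Y] ->
  \sum_(E : {set T} | E \subset X :|: Y) F E
  = \sum_(E1 : {set T} | E1 \subset X)
      \sum_(E2 : {set T} | E2 \subset Y) F (E1 :|: E2).
Proof.
move=> dXY; rewrite pair_big /=.
rewrite (reindex_onto (fun p : {set T} * {set T} => p.1 :|: p.2)
                      (fun E => (E :&: X, E :&: Y))) /=; last first.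
  by move=> E sE; rewrite -setIUr; apply/setIidPl.
apply: eq_bigl => -[E1 E2] /=; apply/andP/andP => [[_ /eqP[<- <-]]|[s1 s2]].
  by rewrite !subsetIr.
split; first by rewrite setUSS.
rewrite !setIUl (setIidPl s1) (setIidPl s2).
have -> : E2 :&: X = set0.
  by apply/eqP; rewrite setI_eq0 disjoint_sym (disjointWr s2).
have -> : E1 :&: Y = set0 by apply/eqP; rewrite setI_eq0 (disjointWl s1).
by rewrite setU0 set0U.
Qed.

Lemma sum_subsetU1 (T : finType) (M : nmodType) (x : T) (V : {set T})
    (F : {set T} -> M) : x \notin V ->
  \sum_(A : {set T} | A \subset x |: V) F A
  = \sum_(A : {set T} | A \subset V) F A
    + \sum_(A : {set T} | A \subset V) F (x |: A).
Proof.
move=> xV; rewrite sum_subsetU; last by rewrite disjoints1.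
rewrite (bigD1 set0) ?sub0set //= [X in _ + X](bigD1 [set x]) /=; last first.
  by rewrite subxx -cards_eq0 cards1.
rewrite [X in _ + (_ + X)]big1 ?addr0 => [|A].
  by congr (_ + _); apply: eq_bigr => A _; rewrite set0U.
by rewrite subset1 -andbA; case/and3P=> /orP[] /eqP ->; rewrite eqxx ?andbF.
Qed.

Lemma sum_subset_mem (T : finType) (M : nmodType) (x : T) (V : {set T})
    (G : {set T} -> M) : x \in V ->
  \sum_(B : {set T} | (B \subset V) && (x \in B)) G B
  = \sum_(A : {set T} | A \subset V :\ x) G (x |: A).
Proof.
move=> xV; rewrite big_mkcondr -{1}(setD1K xV) sum_subsetU1 ?setD11 //=.
rewrite big1 ?add0r => [|A sA].
  by apply: eq_bigr => A _; rewrite setU11.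
by case: ifP => // /(subsetP sA); rewrite setD11.
Qed.

Lemma sum_subset_prod (T : finType) (R : comNzRingType) (X : {set T})
    (f : T -> R) :
  \sum_(E : {set T} | E \subset X) \prod_(p in E) f p
  = \prod_(p in X) (1 + f p).
Proof.
have [n le_Xn] := ubnP #|X|; elim: n => // n IHn in X le_Xn *.
have [->|[x xX]] := set_0Vmem X.
  by rewrite (eq_bigl (pred1 set0)) => [|E]; rewrite ?subset0 // big_pred1_eq !big_set0.
have xX' : x \notin X :\ x by rewrite setD11.
rewrite -(setD1K xX) sum_subsetU1 // big_setU1 //= IHn; last first.
  by move: le_Xn; rewrite (cardsD1 x) xX.
rewrite mulrDl mul1r; congr (_ + _); rewrite -IHn; last first.
  by move: le_Xn; rewrite (cardsD1 x) xX.
rewrite mulr_sumr; apply: eq_bigr => E sE.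
by rewrite big_setU1 //; apply: contra xX' => /(subsetP sE).
Qed.

(** Adding vertices in increasing order makes every edge out of the new vertex a descent and every
    edge into it an ascent. *)
Lemma set_ord_max_ind N (Q : {set 'I_N} -> Prop) :
  Q set0 ->
  (forall m (V : {set 'I_N}),
     m \notin V -> (forall i, i \in V -> (i < m)%N) -> Q V -> Q (m |: V)) ->
  forall V, Q V.
Proof.
move=> Q0 QS V; have [n] := ubnP #|V|; elim: n => // n IHn in V *.
have [->//|[i0 i0V] le_Vn] := set_0Vmem V.
have [m mV' mmax] := arg_maxnP (fun i : 'I_N => i : nat) i0V.
have mV : m \in V by exact: mV'.
rewrite -(setD1K mV); apply: QS => [|i|]; first by rewrite setD11.
  by rewrite !inE => /andP[neim iV]; rewrite ltn_neqAle neim; exact: mmax.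
by apply: IHn; move: le_Vn; rewrite (cardsD1 m) mV.
Qed.

Lemma sum_subset_card (T : finType) (M : nmodType) (V : {set T})
    (G : {set T} -> M) :
  \sum_(A : {set T} | A \subset V) G A
  = \sum_(k < #|V|.+1) \sum_(A : {set T} | (A \subset V) && (#|A| == k)) G A.
Proof.
rewrite (partition_big (fun A : {set T} => inord #|A| : 'I_(#|V|.+1)) xpredT) //=.
apply: eq_bigr => k _; apply: eq_bigl => A.
case sAV: (A \subset V) => //=.
by rewrite -val_eqE /= inordK // ltnS subset_leq_card.
Qed.

(** The sum expands a product of factors 1 - 1 over [X]. *)
Lemma sum_sign_subset (R : comNzRingType) (I : finType) (X : {set I}) :
  X != set0 ->
  \sum_(P : {set I} | P \subset X) (-1) ^+ #|P| = 0 :> R.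
Proof.
case/set0Pn=> x xX.
rewrite (eq_bigr (fun P : {set I} => \prod_(i in P) -1)) => [|P _]; last first.
  by rewrite prodr_const.
by rewrite sum_subset_prod (bigD1 x) //= subrr mul0r.
Qed.

Lemma big_distrlr3 (R : comNzRingType) (I J K : finType)
    (p : pred I) (q : pred J) (r : pred K) (f : I -> R) (g : J -> R)
    (h : K -> R) :
  \sum_(i | p i) \sum_(j | q j) \sum_(k | r k) f i * (g j * h k)
  = (\sum_(i | p i) f i) * ((\sum_(j | q j) g j) * (\sum_(k | r k) h k)).
Proof.
rewrite mulr_suml; apply: eq_bigr => i _.
rewrite big_distrlr mulr_sumr; apply: eq_bigr => j _.
by rewrite mulr_sumr.
Qed.

(** * The differential equation of the logarithm *)

(** In degree m = p+1 the series can be replaced by polynomials. With [H] = [P] - 1, a geometric sum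
    gives [L]' [P] = [P]' (1 - (-[H])^(p+1)); the error term does not reach x^p because [H] has no
    constant term. *)
Lemma fps_log_ode (F : fieldType) (f : fps F) :
  (forall n, (0 < n)%N -> n%:R != 0 :> F) -> f 0%N = 1 ->
  forall m, m%:R * f m = \sum_(i < m.+1) i%:R * fps_log f i * f (m - i)%N.
Proof.
move=> natr_neq0 f0 [|p]; first by rewrite big_ord1 !mul0r.
pose P := \poly_(i < p.+2) f i; pose H : {poly F} := P - 1.
have expNH i : (- H) ^+ i = (-1) ^+ i *: H ^+ i by rewrite -exprZn scaleN1r.
have h0 : fps_sub f fps_one 0%N = 0 by rewrite /fps_sub f0 subrr.
have coefP i : (i < p.+2)%N -> P`_i = f i by move=> lti; rewrite coef_poly lti.
have coefH k i : (i < p.+2)%N -> (H ^+ k)`_i = fps_exp (fps_sub f fps_one) k i.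
  elim: k i => [|k IHk] i lti; first by rewrite coef1.
  rewrite exprS coefM; apply: eq_bigr => j _.
  have ltj : (j < p.+2)%N by apply: leq_ltn_trans (leq_ord j) lti.
  rewrite coefB coefP // coef1 IHk //.
  exact: leq_ltn_trans (leq_subr _ _) lti.
pose L := \sum_(1 <= k < p.+2) ((-1) ^+ k.-1 / k%:R) *: H ^+ k.
have coefL i : (i < p.+2)%N -> L`_i = fps_log f i.
  move=> lti; rewrite coef_sum (@big_cat_nat _ _ _ i.+1) //=.
  rewrite [X in _ + X]big_nat [X in _ + X]big1 ?addr0 => [|k /andP[ltik _]].
    by apply: eq_bigr => k _; rewrite coefZ coefH.
  by rewrite coefZ coefH // fps_exp_lt // mulr0.
have derivL : L^`() * P = P^`() * (1 - (- H) ^+ p.+1).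
  have -> : 1 - (- H) ^+ p.+1 = P * \sum_(i < p.+1) (- H) ^+ i.
    rewrite -[LHS]opprK [- (1 - _)]opprB subrX1 -mulNr; congr (_ * _).
    by rewrite /H; ring.
  rewrite mulrA [RHS]mulrAC; congr (_ * _).
  rewrite /L raddf_sum big_add1 big_mkord mulr_sumr /=.
  apply: eq_bigr => i _; rewrite derivZ deriv_exp /=.
  have -> : H^`() = P^`() by rewrite derivB -polyC1 derivC subr0.
  rewrite -scaler_nat scalerA divfK ?natr_neq0 //.
  by rewrite expNH scalerAr.
have := congr1 (fun q : {poly F} => q`_p) derivL.
rewrite /= mulrBr mulr1 coefB [(_ * (- H) ^+ _)`_p]coefM big1 => [|j _].
  rewrite subr0 coef_deriv coefP // coefM mulr_natl => <-.
  rewrite [RHS]big_ord_recl /= !mul0r add0r; apply: eq_bigr => j _.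
  rewrite coef_deriv coefL ?ltnS ?leq_ord // coefP; last by lia.
  by rewrite [in RHS]mulr_natl /bump add1n subSS.
by rewrite expNH coefZ coefH ?fps_exp_lt ?mulr0 //; lia.
Qed.

(** * Source components and signed sums of digraphs *)

Section Digraphs.

Variables (T : finType) (R : comNzRingType) (wt : T * T -> R).

Implicit Types (V A B : {set T}) (P : {set {set T}}) (E : {set T * T}).

Definition arcs V : {set T * T} :=
  [set p | [&& p.1 \in V, p.2 \in V & p.1 != p.2]].

Definition strong_on B E : bool :=
  [forall a in B, forall b in B, connect (fun s t => (s, t) \in E) a b].

Definition weight E : R := \prod_(p in E) wt p.

(* The weighted count of all subsets of [X]; see [sum_weight]. *)
Definition total_weight (X : {set T * T}) : R := \prod_(p in X) (1 + wt p).

Definition strong_sum V : R :=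
  \sum_(E : {set T * T} | (E \subset arcs V) && strong_on V E) weight E.

(* Strong connectivity is tested with the edges inside [B] only, so that it
   depends on the part of [E] in [arcs B]. *)
Definition source_components V E : {set {set T}} :=
  [set B : {set T} | [&& B != set0, B \subset V, strong_on B (E :&: arcs B)
           & [forall p in E, (p.2 \in B) ==> (p.1 \in B)]]].

(** This is e(V): each block brings one minus sign and a strongly connected digraph on it. *)
Definition signed_sum V : R :=
  \sum_(P : {set {set T}} | partition P V) \prod_(B in P) - strong_sum B.

Lemma strong_onP B E :
  reflect {in B &, forall a b, connect (fun s t => (s, t) \in E) a b}
          (strong_on B E).
Proof.
apply: (iffP forall_inP) => [stB a b aB bB|stB a aB].
  exact: (forall_inP (stB a aB)).
by apply/forall_inP=> b bB; apply: stB.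
Qed.

Lemma source_componentsP V E B :
  reflect [/\ B != set0, B \subset V, strong_on B (E :&: arcs B)
           & forall a b, (a, b) \in E -> b \in B -> a \in B]
          (B \in source_components V E).
Proof.
rewrite inE; apply: (iffP and4P) => -[B0 sB stB clB]; split=> //.
  move=> a b abE; have /implyP/(_ abE)/implyP := forallP clB (a, b).
  exact.
apply/forallP=> -[a b]; apply/implyP=> abE; apply/implyP; exact: clB abE.
Qed.

(** Traced back from its end, the path never leaves [B]. That [E] has no loops matters because
    [arcs B] contains none. *)
Lemma pred_closed_connect E B a b : E \subset arcs setT ->
  (forall a b, (a, b) \in E -> b \in B -> a \in B) ->
  connect (fun s t => (s, t) \in E) a b -> b \in B ->
  a \in B /\ connect (fun s t => (s, t) \in E :&: arcs B) a b.
Proof.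
move=> sE clB /connectP[p pp ->] {b}; elim: p a pp => [|c p IHp] a /=.
  by move=> _ aB; split.
case/andP=> acE pp lB; have [cB cp] := IHp c pp lB.
have aB := clB _ _ acE cB; split=> //; apply: connect_trans cp.
apply: connect1; rewrite inE acE inE /= aB cB.
by have := subsetP sE _ acE; rewrite inE => /and3P[].
Qed.

Lemma arcsS A B : A \subset B -> arcs A \subset arcs B.
Proof.
move=> sAB; apply/subsetP => -[a b]; rewrite !inE /= => /and3P[aA bA ->].
by rewrite !(subsetP sAB).
Qed.

(** If [A] and [B] share v, every vertex of [A] has a path to v, and [B] is closed under
    predecessors; hence [A] lies in [B], and conversely. *)
Lemma trivIset_source_components V E :
  E \subset arcs V -> trivIset (source_components V E).
Proof.
move=> sE; have sET := subset_trans sE (arcsS (subsetT V)).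
suff sub A B v : A \in source_components V E -> B \in source_components V E ->
    v \in A -> v \in B -> A \subset B.
  apply/trivIsetP=> A B AS BS; apply: contraNT => /pred0Pn[v /andP[vA vB]].
  by rewrite eqEsubset (sub A B v) ?(sub B A v).
move=> /source_componentsP[_ _ /strong_onP stA _].
case/source_componentsP=> _ _ _ clB vA vB; apply/subsetP => a aA.
have cav := stA a v aA vA.
have cav' : connect (fun s t => (s, t) \in E) a v.
  by apply: connect_sub cav => s t; rewrite inE => /andP[stE _]; exact: connect1.
by have [] := pred_closed_connect sET clB cav' vB.
Qed.

(** Take a vertex of [V] with the fewest ancestors: its set of ancestors is a source component. *)
Lemma source_components_neq0 V E :
  E \subset arcs V -> V != set0 -> source_components V E != set0.
Proof.
move=> sE /set0Pn[v0 v0V]; have sET := subset_trans sE (arcsS (subsetT V)).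
pose e := fun s t => (s, t) \in E; pose anc v := [set a | connect e a v].
have [v vV vmin] := arg_minnP (fun v => #|anc v|) v0V.
have anc_cl w a b : (a, b) \in E -> b \in anc w -> a \in anc w.
  by rewrite !inE => abE; apply: connect_trans; exact: connect1.
have anc_V w a : w \in V -> a \in anc w -> a \in V.
  move=> wV; rewrite inE => cw.
  have clV b c : (b, c) \in E -> c \in V -> b \in V.
    by move=> /(subsetP sE); rewrite inE => /and3P[].
  by have [] := pred_closed_connect sET clV cw wV.
apply/set0Pn; exists (anc v); apply/source_componentsP; split.
- by apply/set0Pn; exists v; rewrite inE.
- by apply/subsetP => a; apply: anc_V.
- (* [anc b] is contained in [anc v], hence equal to it by minimality. *)
  apply/strong_onP => a b av bv.
  have sub : anc b \subset anc v.
    apply/subsetP => c; rewrite !inE => cb; apply: connect_trans cb _.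
    by rewrite inE in bv.
  have eqb : anc b = anc v.
    by apply/eqP; rewrite eqEcard sub /=; apply: vmin; exact: anc_V bv.
  have cab : connect e a b by move: av; rewrite -eqb inE.
  by have [] := pred_closed_connect sET (anc_cl v) cab bv.
- exact: anc_cl.
Qed.

Lemma arcs0 : arcs set0 = set0.
Proof. by apply/setP => -[a b]; rewrite !inE. Qed.

Lemma total_weightU (X Y : {set T * T}) :
  [disjoint X & Y] -> total_weight (X :|: Y) = total_weight X * total_weight Y.
Proof.
by move=> dXY; rewrite /total_weight -bigU //; apply: eq_bigl => p; rewrite !inE.
Qed.

Lemma weightU (X Y : {set T * T}) :
  [disjoint X & Y] -> weight (X :|: Y) = weight X * weight Y.
Proof.
by move=> dXY; rewrite /weight -bigU //; apply: eq_bigl => p; rewrite !inE.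
Qed.

Lemma sum_weight (X : {set T * T}) :
  \sum_(E : {set T * T} | E \subset X) weight E = total_weight X.
Proof. exact: sum_subset_prod. Qed.

(** No edge enters a block of [P] from outside, so an edge leaving [B] cannot end in another
    block. *)
Lemma source_components_split V P B E : trivIset P -> B \in P ->
  (E \subset arcs V) && (P \subset source_components V E) ->
  E \subset arcs B :|: (setX B (V :\: cover P) :|: arcs (V :\: B)).
Proof.
move=> tiP BP /andP[sE /subsetP sPS]; apply/subsetP => -[a b] abE.
have := subsetP sE _ abE; rewrite !inE /= => /and3P[aV bV ab].
have /source_componentsP[_ _ _ clB] := sPS _ BP.
have [bB|bB] := boolP (b \in B); first by rewrite (clB _ _ abE bB) ab.
rewrite aV bV ab /= !andbT; have [aB|aB] //= := boolP (a \in B).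
rewrite orbF; apply/bigcupP => -[C CP bC].
have /source_componentsP[_ _ _ clC] := sPS _ CP.
have aC := clC _ _ abE bC.
by move: bB; rewrite -(def_pblock tiP BP aB) (def_pblock tiP CP aC) bC.
Qed.

(** The condition on [P] decouples: [E1] alone decides whether [B] is strong, [E3] alone decides
    about the other blocks, and [E2] is free since its edges end outside all blocks. *)
Lemma source_components_join V P B E1 E2 E3 :
  trivIset P -> set0 \notin P -> cover P \subset V -> B \in P ->
  E1 \subset arcs B -> E2 \subset setX B (V :\: cover P) ->
  E3 \subset arcs (V :\: B) ->
  (P \subset source_components V (E1 :|: (E2 :|: E3)))
  = strong_on B E1 && (P :\ B \subset source_components (V :\: B) E3).
Proof.
move=> tiP P0 sPV BP sE1 sE2 sE3; set E := E1 :|: _.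
have in1 a b : (a, b) \in E1 -> [/\ a \in B, b \in B & a != b].
  by move/(subsetP sE1); rewrite inE => /and3P.
have in2 a b : (a, b) \in E2 -> [/\ a \in B, b \in V & b \notin cover P].
  by move/(subsetP sE2); rewrite !inE /= => /and3P[-> -> ->].
have in3 a b : (a, b) \in E3 ->
    [/\ a \in V, b \in V, a \notin B, b \notin B & a != b].
  by move/(subsetP sE3); rewrite !inE /= => /and3P[/andP[-> ->] /andP[-> ->] ->].
have inP C c : C \in P -> c \in C -> c \in cover P.
  by move=> CP cC; apply/bigcupP; exists C.
have disC C c : C \in P -> C != B -> c \in C -> c \in B = false.
  move=> CP neCB cC; apply: contraNF neCB => cB.
  by rewrite -(def_pblock tiP CP cC) (def_pblock tiP BP cB).
have sPi C : C \in P -> C \subset V.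
  by move=> CP; apply: subset_trans sPV; apply: (bigcup_max C).
have EB : E :&: arcs B = E1.
  apply/setP => -[a b]; rewrite !inE /=; apply/idP/idP => [|abE].
    case/andP=> /or3P[//|abE|abE] /and3P[aB bB _].
      by have [_ _] := in2 _ _ abE; rewrite (inP B).
    by have [_ _] := in3 _ _ abE; rewrite aB.
  by rewrite abE; have [-> -> ->] := in1 _ _ abE.
have EC C : C \in P -> C != B -> E :&: arcs C = E3 :&: arcs C.
  move=> CP neCB; apply/setP => -[a b]; rewrite !inE /=.
  case aC: (a \in C); last by rewrite !andbF.
  have aB := disC _ _ CP neCB aC.
  case abE1: (_ \in E1); first by have [] := in1 _ _ abE1; rewrite aB.
  by case abE2: (_ \in E2) => //; have [] := in2 _ _ abE2; rewrite aB.
apply/subsetP/andP => [sPS|[stB /subsetP sPS] C CP].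
  split; first by have /source_componentsP[_ _] := sPS _ BP; rewrite EB.
  apply/subsetP => C; rewrite 2!inE => /andP[neCB CP].
  have /source_componentsP[C0 _ stC clC] := sPS _ CP.
  apply/source_componentsP; split=> //.
  - apply/subsetP => c cC; rewrite inE (disC _ _ CP neCB cC).
    exact: (subsetP (sPi C CP)).
  - by rewrite -EC.
  - by move=> a b abE; apply: clC; rewrite !inE abE !orbT.
have [->|neCB] := eqVneq C B.
  apply/source_componentsP; split=> //; last 1 first.
  - move=> a b; rewrite !inE => /or3P[/in1[] //|/in2[] //|/in3[_ _ _ bB _]].
    by rewrite (negPf bB).
  - by apply: contraNneq P0 => <-.
  - exact: sPi.
  - by rewrite EB.
have /sPS/source_componentsP[C0 _ stC clC] : C \in P :\ B by rewrite !inE neCB.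
apply/source_componentsP; split=> //; first exact: sPi.
- by rewrite EC.
- move=> a b; rewrite !inE => /or3P[/in1[_ bB _]|/in2[_ _ bP]|abE] bC.
  + by rewrite (disC _ _ CP neCB bC) in bB.
  + by rewrite (inP C) in bP.
  + exact: clC abE bC.
Qed.

(** Blocks are split off one at a time. Passing to [V :\: B] and [P :\ B] leaves the same uncovered
    vertices, so the induction varies [V] along with [P]. *)
Lemma sum_source_components V P :
  trivIset P -> set0 \notin P -> cover P \subset V ->
  \sum_(E : {set T * T} | (E \subset arcs V)
      && (P \subset source_components V E)) weight E
  = (\prod_(B in P) strong_sum B) * total_weight (setX (cover P) (V :\: cover P))
    * total_weight (arcs (V :\: cover P)).
Proof.
have [n] := ubnP #|P|; elim: n => // n IHn in P V * => le_Pn tiP P0 sPV.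
have [P_0|[B BP]] := set_0Vmem P.
  rewrite P_0 (eq_bigl (fun E => E \subset arcs V)) => [|E]; last first.
    by rewrite sub0set andbT.
  rewrite sum_weight big_set0 /cover big_set0 setD0 mul1r.
  have -> : setX (set0 : {set T}) V = set0 by apply/setP => -[a b]; rewrite !inE.
  by rewrite {2}/total_weight big_set0 mul1r.
have sBV : B \subset V by apply: subset_trans sPV; apply: (bigcup_max B).
have sBP : B \subset cover P by apply: (bigcup_max B).
pose X := arcs B :|: (setX B (V :\: cover P) :|: arcs (V :\: B)).
have sXV : X \subset arcs V.
  rewrite !subUset !arcsS ?subsetDl // andbT /=.
  apply/subsetP => -[a b]; rewrite !inE /= => /and3P[aB bP bV].
  rewrite (subsetP sBV) // bV; apply: contraNneq bP => <-.
  exact: (subsetP sBP).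
rewrite (eq_bigl (fun E : {set T * T} => (E \subset X)
    && (P \subset source_components V E))) => [|E]; last first.
  apply/idP/idP => [sE|/andP[sEX ->]]; last by rewrite (subset_trans sEX).
  by case/andP: (sE) => _ ->; rewrite andbT; exact: source_components_split sE.
have dX2 : [disjoint setX B (V :\: cover P) & arcs (V :\: B)].
  rewrite -setI_eq0; apply/eqP/setP => -[a b]; rewrite !inE /=.
  by case: (a \in B); rewrite ?andbF.
have dX1 : [disjoint arcs B & setX B (V :\: cover P) :|: arcs (V :\: B)].
  rewrite disjoint_sym -setI_eq0; apply/eqP/setP => -[a b]; rewrite !inE /=.
  case bB: (b \in B); last by rewrite !andbF.
  by rewrite (subsetP sBP) //= !andbF.
rewrite big_mkcondr sum_subsetU //=.
(* The three edge sets are now independent, so the sum becomes a product of three sums. *)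
transitivity (\sum_(E1 : {set T * T} | E1 \subset arcs B)
  \sum_(E2 : {set T * T} | E2 \subset setX B (V :\: cover P))
  \sum_(E3 : {set T * T} | E3 \subset arcs (V :\: B))
    (if strong_on B E1 then weight E1 else 0)
    * (weight E2 * (if P :\ B \subset source_components (V :\: B) E3
                    then weight E3 else 0))).
  apply: eq_bigr => E1 sE1; rewrite sum_subsetU //.
  apply: eq_bigr => E2 sE2; apply: eq_bigr => E3 sE3.
  rewrite (source_components_join tiP P0 sPV BP sE1 sE2 sE3).
  have dE23 : [disjoint E2 & E3] by exact: disjointW sE2 sE3 dX2.
  have dE123 : [disjoint E1 & E2 :|: E3].
    by apply: disjointW sE1 _ dX1; rewrite setUSS.
  case: ifP => [/andP[-> ->]|]; first by rewrite !weightU.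
  by case: ifP => _ //= => [->|_]; rewrite ?mul0r ?mulr0.
rewrite big_distrlr3 -!big_mkcondr sum_weight -/(strong_sum B) IHn; first last.
- by rewrite coverD1 // setSD.
- by apply: contra P0; rewrite inE => /andP[].
- exact: trivIsetD.
- by move: le_Pn; rewrite (cardsD1 B) BP.
rewrite coverD1 // setDDl.
have -> : B :|: cover P :\: B = cover P.
  by rewrite setDE setUIr setUCr setIT; exact/setUidPr.
have -> : setX (cover P) (V :\: cover P)
    = setX B (V :\: cover P) :|: setX (cover P :\: B) (V :\: cover P).
  apply/setP => -[a b]; rewrite !inE /=.
  by case aB: (a \in B) => //=; rewrite (subsetP sBP) //= orbF.
rewrite [\prod_(C in P) _](big_setD1 B BP) /= total_weightU; last first.
  rewrite -setI_eq0; apply/eqP/setP => -[a b]; rewrite !inE /=.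
  by case: (a \in B); rewrite ?andbF.
by rewrite -!mulrA; congr (_ * _); rewrite mulrCA.
Qed.

Lemma signed_sumE V :
  signed_sum V = \sum_(P : {set {set T}} | partition P V)
    (-1) ^+ #|P| * \prod_(B in P) strong_sum B.
Proof. by apply: eq_bigr => P _; rewrite prodrN. Qed.

Lemma signed_sum0 : signed_sum set0 = 1.
Proof.
rewrite /signed_sum (eq_bigl (pred1 set0)) ?big_pred1_eq ?big_set0 // => P.
exact: partition_set0.
Qed.

Lemma signed_sum_cross V :
  \sum_(A : {set T} | A \subset V)
    signed_sum A * total_weight (setX A (V :\: A)) * total_weight (arcs (V :\: A))
  = (V == set0)%:R.
Proof.
(* Pairs of a digraph [E] and a set [P] of its source components are counted twice: first grouped by
   A = [cover P], then for each fixed [E]. *)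
transitivity (\sum_(P : {set {set T}} | [&& trivIset P, set0 \notin P
    & cover P \subset V]) \sum_(E : {set T * T} | E \subset arcs V)
    if P \subset source_components V E then (-1) ^+ #|P| * weight E else 0).
  rewrite [RHS](partition_big cover (fun A => A \subset V)) => [|P /and3P[]] //=.
  apply: eq_bigr => A sAV; rewrite signed_sumE !mulr_suml.
  apply: eq_big => [P|P /and3P[/eqP covP tiP P0]].
    rewrite /partition andbC -!andbA; congr (_ && _).
    by case: eqP => [->|_]; rewrite ?sAV ?andbF ?andbT.
  rewrite -big_mkcondr -mulr_sumr sum_source_components ?covP //.
  by rewrite !mulrA.
rewrite exchange_big /=.
have sumS E : E \subset arcs V -> \sum_(P : {set {set T}} | [&& trivIset P,
    set0 \notin P & cover P \subset V])
    (if P \subset source_components V E then (-1) ^+ #|P| * weight E else 0)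
  = (V == set0)%:R * weight E.
  move=> sE; rewrite -big_mkcondr -mulr_suml; congr (_ * _).
  (* Source components are disjoint, nonempty and inside [V], so [P] ranges over all sets of them
     and the signs cancel. *)
  rewrite (eq_bigl (fun P => P \subset source_components V E)) => [|P]; last first.
    rewrite andb_idl // => sP; apply/and3P; split.
    - exact: trivIsetS (trivIset_source_components sE).
    - by apply/negP => /(subsetP sP)/source_componentsP[]; rewrite eqxx.
    - by apply/bigcupsP => B /(subsetP sP)/source_componentsP[].
  have [V0|V0] := eqVneq; last first.
    by rewrite sum_sign_subset ?source_components_neq0.
  rewrite (eq_bigl (pred1 set0)) ?big_pred1_eq ?cards0 // => P /=.
  rewrite -subset0; suff -> : source_components V E = set0 by [].
  apply/setP => B; rewrite [RHS]inE; apply/source_componentsP => -[B0 sB _ _].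
  by move: B0; rewrite -subset0 -V0 sB.
rewrite (eq_bigr _ sumS) -mulr_sumr sum_weight; case: eqP => [->|_].
  by rewrite arcs0 /total_weight big_set0 mulr1.
by rewrite mul0r.
Qed.

(** Partitions of [V] are grouped by the block [B] containing v; removing it is a bijection onto the
    partitions of [V :\: B]. *)
Lemma signed_sum_rec V v : v \in V ->
  signed_sum V = \sum_(B : {set T} | (B \subset V) && (v \in B))
    - strong_sum B * signed_sum (V :\: B).
Proof.
move=> vV; rewrite /signed_sum.
rewrite (partition_big (fun P : {set {set T}} => pblock P v)
  (fun B => (B \subset V) && (v \in B))) => [|P parP] /=; last first.
  have vP : v \in cover P by rewrite (cover_partition parP).
  by rewrite mem_pblock vP (partitionS parP) ?pblock_mem.
apply: eq_bigr => B /andP[sBV vB]; rewrite mulr_sumr.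
have notin P : partition P (V :\: B) -> B \notin P.
  move=> parP; apply/negP => /(partitionS parP)/subsetP/(_ v vB).
  by rewrite inE vB.
rewrite (reindex_onto (fun P => B |: P) (fun P : {set {set T}} => P :\ B)) /=.
  apply: eq_big => [P|P].
    apply/idP/idP => [/andP[/andP[parP _] /eqP eqP]|parP].
      by rewrite -eqP partitionD1 // setU11.
    rewrite setU1K ?notin // eqxx andbT.
    have parBP : partition (B |: P) V.
      have -> : V = B :|: V :\: B.
        by apply/esym; rewrite setDE setUIr setUCr setIT; exact/setUidPr.
      apply: partitionU1 => //; first by apply/set0Pn; exists v.
      by rewrite -setI_eq0 setDE setICA setICr setI0.
    by rewrite parBP (def_pblock (partition_trivIset parBP) (setU11 _ _) vB) eqxx.
  case/andP=> /andP[parP _] /eqP eqP; rewrite big_setU1 // notin //.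
  by rewrite -eqP partitionD1 // setU11.
move=> P /andP[parP /eqP <-]; rewrite setD1K // pblock_mem //.
by rewrite (cover_partition parP).
Qed.

End Digraphs.

(** * Descent weights and q-binomial coefficients *)

Section Descents.

Variables (R : comNzRingType) (u y : R).

Definition descent_weight n (p : 'I_n * 'I_n) : R :=
  if (p.2 < p.1)%N then u * y else y.

Lemma weight_descent n (E : {set 'I_n * 'I_n}) :
  weight (@descent_weight n) E = u ^+ des E * y ^+ #|E|.
Proof.
have -> : weight (@descent_weight n) E
    = \prod_(p in E) ((if (p.2 < p.1)%N then u else 1) * y).
  apply: eq_bigr => p _; rewrite /descent_weight.
  by case: ifP; rewrite ?mul1r.
rewrite big_split /= prodr_const; congr (_ * _).
rewrite -big_mkcondr /des -prodr_const.
by apply: eq_bigl => p; rewrite inE.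
Qed.

(* With q = (1+uy)/(1+y), [hsum k] is (1+y)^(k-1) (1+q+...+q^(k-1)). *)
Definition hsum k : R := \sum_(i < k) (1 + u * y) ^+ i * (1 + y) ^+ (k.-1 - i).

(** The denominator in [Delta], written without division so that it makes sense over any commutative
    ring; see [hfact_qfact]. *)
Definition hfact n : R := \prod_(1 <= k < n.+1) hsum k.

(** The homogeneous form of [k+l]_q = [k]_q + q^k [l]_q. *)
Lemma hsumD k l :
  hsum (k + l) = (1 + y) ^+ l * hsum k + (1 + u * y) ^+ k * hsum l.
Proof.
rewrite /hsum big_split_ord /= !mulr_sumr; congr (_ + _); apply: eq_bigr => i _.
  rewrite mulrCA -exprD; congr (_ * _ ^+ _).
  by have := ltn_ord i; lia.
rewrite mulrA -exprD; congr (_ * _ ^+ _).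
by have := ltn_ord i; lia.
Qed.

Lemma hfact0 : hfact 0 = 1. Proof. by rewrite /hfact big_geq. Qed.

Lemma hfactS n : hfact n.+1 = hsum n.+1 * hfact n.
Proof. by rewrite /hfact big_nat_recr //= mulrC. Qed.

Lemma total_weight_const n (X : {set 'I_n * 'I_n}) c :
  {in X, forall p, descent_weight p = c} ->
  total_weight (@descent_weight n) X = (1 + c) ^+ #|X|.
Proof. by move=> cX; rewrite -prodr_const; apply: eq_bigr => p /cX ->. Qed.

(** Each pair of vertices admits one descent and one ascent, chosen independently. *)
Lemma total_weight_arcs n (V : {set 'I_n}) :
  total_weight (@descent_weight n) (arcs V)
  = ((1 + u * y) * (1 + y)) ^+ 'C(#|V|, 2).
Proof.
elim/set_ord_max_ind: V => [|m V mV Vm IHV].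
  by rewrite arcs0 /total_weight big_set0 cards0 bin0n.
have -> : arcs (m |: V) = arcs V :|: (setX [set m] V :|: setX V [set m]).
  apply/setP => -[a b]; rewrite !inE /=.
  have [->|nam] := eqVneq a m; have [->|nbm] := eqVneq b m;
    rewrite ?(negPf mV) ?eqxx ?(eq_sym m) ?nam ?nbm //=;
    by case: (a \in V); case: (b \in V); case: (a == b).
have dV1 : [disjoint setX [set m] V & setX V [set m]].
  rewrite -setI_eq0; apply/eqP/setP => -[a b]; rewrite !inE /=.
  by case: eqP => //= ->; rewrite (negPf mV) andbF.
have dV2 : [disjoint arcs V & setX [set m] V :|: setX V [set m]].
  rewrite -setI_eq0; apply/eqP/setP => -[a b]; rewrite !inE /=.
  by have [->|_] := eqVneq a m; have [->|_] := eqVneq b m;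
    rewrite ?(negPf mV) ?andbF.
rewrite !total_weightU // IHV cardsU1 mV addnC addn1 binS bin1 addnC exprD mulrC.
rewrite (@total_weight_const _ _ (u * y)) ?(@total_weight_const _ _ y) ?cardsX ?cards1.
- by rewrite mul1n muln1 -exprMn mulrC.
- move=> [a b]; rewrite !inE /= => /andP[aV /eqP->].
  by rewrite /descent_weight /= ltnNge ltnW ?Vm.
- move=> [a b]; rewrite !inE /= => /andP[/eqP-> bV].
  by rewrite /descent_weight /= Vm.
Qed.

(** When q = (1+uy)/(1+y) makes sense, this is the q-binomial coefficient of |V| and k times
    (1+y)^(k(|V|-k)). *)
Definition cross_sum n (V : {set 'I_n}) k : R :=
  \sum_(A : {set 'I_n} | (A \subset V) && (#|A| == k))
    total_weight (@descent_weight n) (setX A (V :\: A)).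

Lemma cross_sum_gt n (V : {set 'I_n}) k : (#|V| < k)%N -> cross_sum V k = 0.
Proof.
move=> ltVk; rewrite /cross_sum big_pred0 // => A.
apply/negbTE/andP => -[/subset_leq_card leAV /eqP cA].
by move: leAV; rewrite cA leqNgt ltVk.
Qed.

Lemma cross_sum0 n (V : {set 'I_n}) : cross_sum V 0 = 1.
Proof.
rewrite /cross_sum (eq_bigl (pred1 set0)) => [|A]; last first.
  by rewrite cards_eq0 andbC /=; case: eqP => // ->; rewrite sub0set.
rewrite big_pred1_eq (_ : setX _ _ = set0) /total_weight ?big_set0 //.
by apply/setP => -[a b]; rewrite !inE.
Qed.

(** The q-Pascal rule. If m is not in A, the k+1 possible edges from A to m are ascents; if m is in
    A, the |V|-k possible edges from m to the complement are descents. *)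
Lemma cross_sumS n (m : 'I_n) (V : {set 'I_n}) k :
  m \notin V -> (forall i, i \in V -> (i < m)%N) ->
  cross_sum (m |: V) k.+1 = (1 + y) ^+ k.+1 * cross_sum V k.+1
    + (1 + u * y) ^+ (#|V| - k) * cross_sum V k.
Proof.
move=> mV Vm; rewrite /cross_sum big_mkcondr sum_subsetU1 //=.
rewrite -!big_mkcondr !mulr_sumr; congr (_ + _).
  apply: eq_bigr => A /andP[sAV /eqP cA].
  have mA : m \notin A by apply: contra mV => /(subsetP sAV).
  have -> : setX A ((m |: V) :\: A) = setX A [set m] :|: setX A (V :\: A).
    apply/setP => -[a b]; rewrite !inE /=.
    have [->|_] := eqVneq b m; rewrite ?(negPf mA) ?(negPf mV);
      by case: (a \in A); case: (b \in A); case: (b \in V).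
  rewrite total_weightU; last first.
    rewrite -setI_eq0; apply/eqP/setP => -[a b]; rewrite !inE /=.
    by have [->|_] := eqVneq b m; rewrite ?(negPf mV) ?andbF.
  rewrite (@total_weight_const _ _ y) ?cardsX ?cards1 ?muln1 ?cA // => -[a b].
  rewrite !inE /= => /andP[/(subsetP sAV) aV /eqP->].
  by rewrite /descent_weight /= ltnNge ltnW ?Vm.
apply: eq_big => [A|A].
  case sAV: (A \subset V) => //=; rewrite cardsU1.
  by rewrite (contra (subsetP sAV m) mV) eqSS.
case/andP=> sAV; rewrite cardsU1.
have mA : m \notin A by apply: contra mV => /(subsetP sAV).
rewrite mA eqSS => /eqP cA.
have -> : setX (m |: A) ((m |: V) :\: (m |: A))
    = setX [set m] (V :\: A) :|: setX A (V :\: A).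
  apply/setP => -[a b]; rewrite !inE /=.
  have [->|_] := eqVneq b m; rewrite ?(negPf mV) ?andbF //=.
  by case: (a == m); case: (a \in A); case: (b \in A); case: (b \in V).
rewrite total_weightU; last first.
  rewrite -setI_eq0; apply/eqP/setP => -[a b]; rewrite !inE /=.
  by have [->|_] := eqVneq a m; rewrite ?(negPf mA) ?andbF.
rewrite (@total_weight_const _ _ (u * y)) ?cardsX ?cards1 ?mul1n.
  by rewrite cardsD (setIidPr sAV) cA.
move=> [a b]; rewrite !inE /= => /and3P[/eqP-> _ bV].
by rewrite /descent_weight /= Vm.
Qed.

Lemma cross_sum_hfact n (V : {set 'I_n}) k : (k <= #|V|)%N ->
  cross_sum V k * (hfact k * hfact (#|V| - k)) = hfact #|V|.
Proof.
elim/set_ord_max_ind: V k => [|m V mV Vm IHV] k.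
  by rewrite cards0 leqn0 => /eqP->; rewrite cross_sum0 hfact0 !mulr1.
case: k => [|k]; first by rewrite cross_sum0 hfact0 !mul1r subn0.
rewrite cardsU1 mV add1n ltnS subSS => le_kV.
rewrite cross_sumS // mulrDl.
(* Splitting |V|+1 as (|V|-k) + (k+1) matches the two terms of the Pascal rule. *)
have -> : hfact #|V|.+1 = (1 + y) ^+ k.+1 * hsum (#|V| - k) * hfact #|V|
    + (1 + u * y) ^+ (#|V| - k) * hsum k.+1 * hfact #|V|.
  by rewrite hfactS -mulrDl -hsumD addnS subnK.
congr (_ + _); last by rewrite -(IHV k) // hfactS !mulrA; ring.
(* At k = |V| both sides vanish: no subset has |V|+1 elements, and [hsum 0] is an empty sum. *)
have [lt_kV|le_Vk] := ltnP k #|V|; last first.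
  by rewrite cross_sum_gt // (eqP le_Vk) /hsum big_ord0 !(mulr0, mul0r).
rewrite -(IHV k.+1) // -[(#|V| - k)%N]prednK ?subn_gt0 // -subnS (hfactS (_ - _)).
by ring.
Qed.

End Descents.

(** * From vertex sets to power series *)

Section Field.

Variables (F : fieldType) (u y : F).
Hypothesis y1_neq0 : 1 + y != 0.
Hypothesis qfact_neq0 : forall n, qfact (q_ u y) n != 0.

Lemma s_strong_sum n : s_ u y n = strong_sum (descent_weight u y (n := n)) setT.
Proof.
apply: eq_big => [E|E _]; last by rewrite weight_descent.
congr (_ && _); last first.
  apply: eq_forallb => a; rewrite inE /=; apply: eq_forallb => b.
  by rewrite inE.
apply/forall_inP/subsetP => EP p /EP; rewrite !inE //.
Qed.

Lemma hfact_qfact n : hfact u y n = qfact (q_ u y) n * (1 + y) ^+ 'C(n, 2).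
Proof.
elim: n => [|n IHn].
  by rewrite hfact0 /qfact big_geq // bin0n mulr1.
have -> : qfact (q_ u y) n.+1
    = (\sum_(i < n.+1) q_ u y ^+ i) * qfact (q_ u y) n.
  by rewrite /qfact big_nat_recr //= mulrC.
have hsumE : hsum u y n.+1 = (\sum_(i < n.+1) q_ u y ^+ i) * (1 + y) ^+ n.
  rewrite mulr_suml; apply: eq_bigr => i _ /=.
  rewrite /q_ expr_div_n -mulrA; congr (_ * _); rewrite mulrC.
  by rewrite expfB_cond // (negPf y1_neq0) add0n -ltnS.
by rewrite hfactS IHn binS bin1 exprD hsumE; ring.
Qed.

Lemma hfact_neq0 n : hfact u y n != 0.
Proof. by rewrite hfact_qfact mulf_neq0 ?expf_neq0. Qed.

Lemma D_hfact n :
  D_ u y n = ((1 + u * y) * (1 + y)) ^+ 'C(n, 2) / hfact u y n.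
Proof.
rewrite hfact_qfact /D_ exprMn -mulf_div divff ?mulr1 //.
exact: expf_neq0.
Qed.

(** Both sides solve the recursion of [signed_sum_cross], where the term A = V has coefficient 1 and
    is thus determined by the proper subsets. For the right side the recursion is D times 1/D equals
    1. *)
Lemma signed_sum_invD n (V : {set 'I_n}) :
  signed_sum (descent_weight u y (n := n)) V
  = fps_inv (D_ u y) #|V| * hfact u y #|V|.
Proof.
have [m] := ubnP #|V|; elim: m => // m IHm in V * => le_Vm.
pose w := descent_weight u y (n := n); pose G (A : {set 'I_n}) :=
  fps_inv (D_ u y) #|A| * hfact u y #|A| * total_weight w (setX A (V :\: A))
  * total_weight w (arcs (V :\: A)).
have sumG : \sum_(A : {set 'I_n} | A \subset V) G A = (V == set0)%:R.
  rewrite sum_subset_card.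
  (* The sets A of size k together give [cross_sum V k], whose product formula produces the
     convolution. *)
  transitivity (\sum_(k < #|V|.+1)
      hfact u y #|V| * (D_ u y (#|V| - k)%N * fps_inv (D_ u y) k)).
    apply: eq_bigr => k _; have le_kV : (k <= #|V|)%N by rewrite -ltnS.
    rewrite -(cross_sum_hfact u y le_kV) D_hfact /cross_sum !mulr_suml.
    apply: eq_bigr => A /andP[sAV /eqP cA].
    rewrite /G total_weight_arcs cA cardsD (setIidPr sAV) cA -/w.
    have := hfact_neq0 (#|V| - k)%N; move: (hfact _ _ (_ - _)) => h h0.
    move: (_ ^+ _) (total_weight _ _) (fps_inv _ _) (hfact _ _ _) => c t i g.
    by field.
  rewrite -mulr_sumr; have := @fps_mulV _ (D_ u y) _ #|V|.
  rewrite D_0 oner_neq0 => /(_ isT); rewrite /fps_mul.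
  rewrite (reindex_inj rev_ord_inj) /=.
  under eq_bigr => k _ do rewrite subSS (subKn (leq_ord k)).
  move=> ->; rewrite /fps_one cards_eq0; case: eqP => [->|_].
    by rewrite cards0 hfact0 mul1r.
  by rewrite mulr0.
have := signed_sum_cross w V; rewrite -sumG.
rewrite (bigD1 V) //= [RHS](bigD1 V) //=.
have -> : \sum_(A : {set 'I_n} | (A \subset V) && (A != V)) G A
  = \sum_(A : {set 'I_n} | (A \subset V) && (A != V))
    signed_sum w A * total_weight w (setX A (V :\: A)) * total_weight w (arcs (V :\: A)).
  apply: eq_bigr => A sAV; rewrite /G IHm //.
  by apply: leq_trans (proper_card _) le_Vm; rewrite properEneq andbC.
move/addIr; rewrite /G setDv arcs0 (_ : setX V set0 = set0).
  by rewrite /total_weight big_set0 !mulr1.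
by apply/setP => -[a b]; rewrite !inE andbF.
Qed.

(** By the differential equation, the negated logarithm coefficients satisfy [signed_sum_rec], whose
    term B = V determines the strong sum of V from those of smaller sets. *)
Lemma strong_sum_log (f : fps F) n (V : {set 'I_n}) :
  (forall A : {set 'I_n}, signed_sum (descent_weight u y (n := n)) A
     = #|A|`!%:R * f #|A|) ->
  (forall m, m%:R * f m = \sum_(i < m.+1) i%:R * fps_log f i * f (m - i)%N) ->
  V != set0 ->
  strong_sum (descent_weight u y (n := n)) V = - (#|V|`!%:R * fps_log f #|V|).
Proof.
move=> sgnf logf.
have [m] := ubnP #|V|; elim: m => // m IHm in V * => le_Vm.
case/set0Pn=> v vV; pose w := descent_weight u y (n := n).
have V0 : (0 < #|V|)%N by rewrite (cardD1 v) vV.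
pose G (B : {set 'I_n}) := #|B|`!%:R * fps_log f #|B| * signed_sum w (V :\: B).
have sumG : \sum_(B : {set 'I_n} | (B \subset V) && (v \in B)) G B
   = signed_sum w V.
  rewrite sum_subset_mem // sum_subset_card sgnf.
  have [p cV] : exists p, #|V| = p.+1 by exists #|V|.-1; rewrite prednK.
  have cVv : #|V :\ v| = p by move: cV; rewrite (cardsD1 v) vV => -[].
  (* The factor p+1 of |V|! supplies the left side of the differential equation. Its term i = 0
     vanishes, so i = k+1 is the size of B. *)
  rewrite cVv cV factS natrM -mulrA mulrCA logf [in RHS]big_ord_recl /= !mul0r add0r.
  rewrite mulr_sumr; apply: eq_bigr => k _.
  have le_kp : (k <= p)%N by rewrite -ltnS.
  transitivity (\sum_(A : {set 'I_n} | (A \subset V :\ v) && (#|A| == k))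
      k.+1`!%:R * fps_log f k.+1 * ((p - k)`!%:R * f (p - k)%N)).
    apply: eq_bigr => A /andP[sA /eqP cA].
    have vA : v \notin A by apply/negP => /(subsetP sA); rewrite setD11.
    rewrite /G sgnf cardsU1 vA cA -setDDl cardsD cVv (setIidPr sA) cA.
    by rewrite add1n.
  (* There are binom(p,k) sets A, and binom(p,k) (k+1)! (p-k)! = (k+1) p!. *)
  rewrite sumr_const -cardsE cards_draws cVv -(bin_fact le_kp).
  rewrite -[LHS]mulr_natl factS !natrM /bump /= add1n subSS.
  by ring.
have := signed_sum_rec w vV; rewrite -sumG.
rewrite (bigD1 V) ?subxx //= [RHS](bigD1 V) ?subxx //=.
have -> : \sum_(B : {set 'I_n} | (B \subset V) && (v \in B) && (B != V)) G B
  = \sum_(B : {set 'I_n} | (B \subset V) && (v \in B) && (B != V))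
      - strong_sum w B * signed_sum w (V :\: B).
  apply: eq_bigr => B /andP[/andP[sBV vB] neBV]; rewrite /G IHm ?opprK //.
    by apply: leq_trans (proper_card _) le_Vm; rewrite properEneq neBV.
  by apply/set0Pn; exists v.
by move/addIr; rewrite /G setDv signed_sum0 !mulr1 => ->; rewrite opprK.
Qed.

End Field.

Theorem theorem3p6 :
  S_ uvar yvar =1
    fps_opp (fps_log (Delta_inv uvar yvar (fps_inv (D_ uvar yvar)))).
Proof.
set f := Delta_inv _ _ _.
have f0 : f 0%N = 1 by exact: Delta_inv_invD_0.
(* Both constant terms are 0; the logarithm identity for strong sums needs a nonempty vertex set. *)
move=> [|n]; first by rewrite /S_ /fps_opp /fps_log big_geq // oppr0.
have sgnf A : signed_sum (descent_weight uvar yvar (n := n.+1)) A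
    = #|A|`!%:R * f #|A|.
  rewrite (signed_sum_invD add1y_neq0 qfact_neq0) (hfact_qfact _ add1y_neq0).
  by rewrite /f /Delta_inv [RHS]mulrC divfK // natr_Quy_neq0 ?fact_gt0.
rewrite /S_ /= s_strong_sum (strong_sum_log sgnf).
- by rewrite cardsT card_ord mulrC mulrN mulKf ?natr_Quy_neq0 ?fact_gt0.
- exact: fps_log_ode natr_Quy_neq0 f0.
- by rewrite -cards_eq0 cardsT card_ord.
Qed.
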